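(* Let $\phi$ be a formula of hybrid logic and let $\Gamma$ be a set of formulas of hybrid logic. Then statement (1) below implies statement (2). (1) For any model $\mathfrak{M}=(W,R,\{V_w\}_{w\in W})$, any world $w\in W$, and any assignment $g$: if $\mathfrak{M},g,w\models\xi$ for every formula $\xi\in\Gamma$, then $\mathfrak{M},g,w\models\phi$. (2) There exists a derivation of $\phi$ from $\Gamma$ in the natural deduction system $\mathbf{N}'_{\mathcal{H}}$ such that any formula $\theta$ occurring in the derivation has at least one of the following five properties: (i) $\theta$ is of the form $@_a\psi$, where $a$ is a nominal and $\psi$ is a subformula of $\phi$, of some formula in $\Gamma$, or of some formula of the form $c$ or $\Diamond c$ with $c$ a nominal. (ii) $\theta$ is a subformula of $\phi$, of some formula in $\Gamma$, or of some formula of the form $c$ or $\Diamond c$ with $c$ a nominal. (iii) $\theta$ is a nominal. (iv) $\theta$ is of the form $@_a(p\to\bot)$ or $p\to\bot$, where $a$ is a nominal and $p$ is an ordinary propositional symbol that is a subformula of $\phi$ or of some formula in $\Gamma$. (v) $\theta$ is of the form $@_a\bot$ (with $a$ a nominal) or $\theta$ is $\bot$.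
   Context: **Syntax.** A set of ordinary propositional symbols and a countably infinite set of nominals are given; the two sets are disjoint. The letters $p,q,r,\ldots$ range over ordinary propositional symbols and $a,b,c,d,e,\ldots$ over nominals. Formulas are given by the grammar $$S ::= p \mid a \mid S\wedge S \mid S\to S \mid \bot \mid \Box S \mid @_a S.$$ $\neg\phi$ abbreviates $\phi\to\bot$, and $\Diamond\phi$ abbreviates $\neg\Box\neg\phi$ (so $\Diamond c$ is the formula $\Box(c\to\bot)\to\bot$). A formula of the form $@_a\phi$ is called a satisfaction statement. Subformulas are defined as usual with respect to the primitive syntax. A propositional letter is an ordinary propositional symbol or a nominal. **Semantics.** A model is a tuple $\mathfrak{M}=(W,R,\{V_w\}_{w\in W})$, where $W$ is a non-empty set, $R$ is a binary relation on $W$, and for each $w\in W$, $V_w$ is a function assigning an element of $\{0,1\}$ to each ordinary propositional symbol. An assignment is a function $g$ assigning an element of $W$ to each nominal. The relation $\mathfrak{M},g,w\models\phi$ is defined inductively: - $\mathfrak{M},g,w\models p$ iff $V_w(p)=1$; - $\mathfrak{M},g,w\models a$ iff $w=g(a)$; - $\mathfrak{M},g,w\models\phi\wedge\psi$ iff $\mathfrak{M},g,w\models\phi$ and $\mathfrak{M},g,w\models\psi$; - $\mathfrak{M},g,w\models\phi\to\psi$ iff $\mathfrak{M},g,w\models\phi$ implies $\mathfrak{M},g,w\models\psi$; - $\mathfrak{M},g,w\models\bot$ never holds; - $\mathfrak{M},g,w\models\Box\phi$ iff $\mathfrak{M},g,v\models\phi$ for every $v\in W$ with $wRv$; - $\mathfrak{M},g,w\models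 @_a\phi$ iff $\mathfrak{M},g,g(a)\models\phi$. **Derivations.** A derivation is a finite tree whose nodes are labelled with formulas, such that each formula occurrence either is a leaf (an assumption) or is the conclusion of a rule-instance whose premises are its immediate successors. The root is the end-formula. Each assumption is annotated with a number and is either undischarged or discharged at one particular rule-instance. A rule-instance annotated with a number discharges all undischarged assumptions above it (in the relevant premise subderivation) that carry that number and are occurrences of the formula determined by the rule; as usual in natural deduction, the set of discharged occurrences may be empty. A derivation of $\phi$ from $\Gamma$ is a derivation with end-formula $\phi$ in which every undischarged assumption is an occurrence of a formula in $\Gamma$. **The system $\mathbf{N}'_{\mathcal{H}}$** has the following rules. - $(\wedge I)$: from $\phi$ and $\psi$ infer $\phi\wedge\psi$. - $(\wedge E1)$, $(\wedge E2)$: from $\phi\wedge\psi$ infer $\phi$; from $\phi\wedge\psi$ infer $\psi$. - $(\to I)$: from a derivation of $\psi$ infer $\phi\to\psi$, discharging assumptions $\phi$. - $(\to E)$: from $\phi\to\psi$ and $\phi$ infer $\psi$. - $(\bot)$: from a derivation of $\bot$ infer $\phi$, discharging assumptions $\neg\phi$. Side-condition: $\phi$ is a propositional letter. - $(@I)$: from $a$ and $\phi$ infer $@_a\phi$. - $(@E)$: from $a$ and $@_a\phi$ infer $\phi$. - $(\Box I)$: from a derivation of $@_c\phi$ infer $\Box\phi$, discharging assumptions $\Diamond c$. Side-condition: $c$ does not occur in $\Box\phi$ or in any undischarged assumption (of the derivation of the premise) other than the specified occurrences of $\Diamond c$. - $(\Box E)$: from $\Box\phi$ and $\Diamond e$ infer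 $@_e\phi$, where $e$ is any nominal. - $(Term)$: from derivations of $\phi_1,\ldots,\phi_n$ ($n\ge 0$) and a derivation of $\psi$, infer $\psi$, discharging in the derivation of the last premise $\psi$ the assumptions $\phi_1,\ldots,\phi_n$ and $a$ ($a$ a nominal). Side-conditions: $\phi_1,\ldots,\phi_n$ and $\psi$ are all satisfaction statements, and the derivation of the last premise $\psi$ has no undischarged assumptions besides the specified occurrences of $\phi_1,\ldots,\phi_n$ and $a$. - $(Name)$: from a derivation of $\psi$ infer $\psi$, discharging assumptions $a$ ($a$ a nominal). Side-condition: $a$ does not occur in $\psi$ or in any undischarged assumption other than the specified occurrences of $a$. *)

(* Defs.v *)
From Stdlib Require Export List.
From Stdlib Require Export FinFun.
Set Implicit Arguments.
Unset Strict Implicit.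

Inductive form (P N : Type) : Type :=
| Prp (p : P)
| Nom (a : N)
| And (phi psi : form P N)
| Imp (phi psi : form P N)
| Bot
| Box (phi : form P N)
| At (a : N) (phi : form P N).

Arguments Prp {P N} p.
Arguments Nom {P N} a.
Arguments Bot {P N}.

Definition Neg (P N : Type) (phi : form P N) : form P N := Imp phi Bot.
Definition Dia (P N : Type) (phi : form P N) : form P N := Neg (Box (Neg phi)).

Definition is_letter (P N : Type) (phi : form P N) : Prop :=
  (exists p, phi = Prp p) \/ (exists a, phi = Nom a).

Definition is_satisfaction (P N : Type) (phi : form P N) : Prop :=
  exists a psi, phi = At a psi.

(* The nominal of [At a phi] is not itself counted as a subformula. *)
Fixpoint subformula (P N : Type) (psi phi : form P N) : Prop :=
  psi = phi \/
  match phi with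
  | And phi1 phi2 | Imp phi1 phi2 => subformula psi phi1 \/ subformula psi phi2
  | Box phi1 | At _ phi1 => subformula psi phi1
  | Prp _ | Nom _ | Bot => False
  end.

Fixpoint nom_occurs (P N : Type) (c : N) (phi : form P N) : Prop :=
  match phi with
  | Prp _ | Bot => False
  | Nom a => c = a
  | And phi1 phi2 | Imp phi1 phi2 => nom_occurs c phi1 \/ nom_occurs c phi2
  | Box phi1 => nom_occurs c phi1
  | At a phi1 => c = a \/ nom_occurs c phi1
  end.

Record model (P : Type) : Type := Model {
  world : Type;
  world_inhabited : inhabited world;
  acc : world -> world -> Prop;
  val : world -> P -> bool
}.

Fixpoint sat (P N : Type) (M : model P) (g : N -> world M) (w : world M)
    (phi : form P N) : Prop :=
  match phi with
  | Prp p => val w p = true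
  | Nom a => w = g a
  | And phi1 phi2 => sat g w phi1 /\ sat g w phi2
  | Imp phi1 phi2 => sat g w phi1 -> sat g w phi2
  | Bot => False
  | Box phi1 => forall v, acc w v -> sat g v phi1
  | At a phi1 => sat g (g a) phi1
  end.

(* Trees of rule-instances.  Each node carries the instantiation of the
   schematic letters of its rule; the argument [k : nat] is the number annotating
   an assumption, or a rule-instance that can discharge assumptions.
   Whether the premises match the rule and the side-conditions hold is the
   business of [correct] below. *)
Inductive tree (P N : Type) : Type :=
| Assume (k : nat) (phi : form P N)
| AndI (phi psi : form P N) (d1 d2 : tree P N)
| AndE1 (phi psi : form P N) (d : tree P N)
| AndE2 (phi psi : form P N) (d : tree P N)
| ImpI (k : nat) (phi psi : form P N) (d : tree P N)
| ImpE (phi psi : form P N) (d1 d2 : tree P N)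
| BotC (k : nat) (phi : form P N) (d : tree P N)
| AtI (a : N) (phi : form P N) (d1 d2 : tree P N)
| AtE (a : N) (phi : form P N) (d1 d2 : tree P N)
| BoxI (k : nat) (c : N) (phi : form P N) (d : tree P N)
| BoxE (e : N) (phi : form P N) (d1 d2 : tree P N)
| Term (k : nat) (a : N) (psi : form P N) (ds : list (tree P N)) (d : tree P N)
| Name (k : nat) (a : N) (psi : form P N) (d : tree P N).

Definition concl (P N : Type) (d : tree P N) : form P N :=
  match d with
  | Assume _ phi => phi
  | AndI phi psi _ _ => And phi psi
  | AndE1 phi _ _ => phi
  | AndE2 _ psi _ => psi
  | ImpI _ phi psi _ => Imp phi psi
  | ImpE _ psi _ _ => psi
  | BotC _ phi _ => phi
  | AtI a phi _ _ => At a phi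
  | AtE _ phi _ _ => phi
  | BoxI _ _ phi _ => Box phi
  | BoxE e phi _ _ => At e phi
  | Term _ _ psi _ _ => psi
  | Name _ _ psi _ => psi
  end.

Fixpoint occurs (P N : Type) (theta : form P N) (d : tree P N) : Prop :=
  theta = concl d \/
  match d with
  | Assume _ _ => False
  | AndI _ _ d1 d2 | ImpE _ _ d1 d2 | AtI _ _ d1 d2 | AtE _ _ d1 d2
  | BoxE _ _ d1 d2 => occurs theta d1 \/ occurs theta d2
  | AndE1 _ _ d1 | AndE2 _ _ d1 | ImpI _ _ _ d1 | BotC _ _ d1
  | BoxI _ _ _ d1 | Name _ _ _ d1 => occurs theta d1
  | Term _ _ _ ds d1 =>
      fold_right (fun d' Q => occurs theta d' \/ Q) (occurs theta d1) ds
  end.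

(* A set of annotated assumptions is a predicate on numbers and formulas; a
   rule-instance numbered [k] discharges in [A] the formulas of [D] numbered
   [k]. *)
Definition discharge (P N : Type) (k : nat) (D : form P N -> Prop)
    (A : nat -> form P N -> Prop) (j : nat) (chi : form P N) : Prop :=
  A j chi /\ ~ (j = k /\ D chi).

Definition term_discharged (P N : Type) (a : N) (ds : list (tree P N))
    (chi : form P N) : Prop :=
  chi = Nom a \/ In chi (map (@concl P N) ds).

(* [undischarged d j chi]: some undischarged assumption of [d] is an occurrence
   of [chi] numbered [j]. *)
Fixpoint undischarged (P N : Type) (d : tree P N) (j : nat) (chi : form P N) :
    Prop :=
  match d with
  | Assume k phi => j = k /\ chi = phi
  | AndI _ _ d1 d2 | ImpE _ _ d1 d2 | AtI _ _ d1 d2 | AtE _ _ d1 d2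
  | BoxE _ _ d1 d2 => undischarged d1 j chi \/ undischarged d2 j chi
  | AndE1 _ _ d1 | AndE2 _ _ d1 => undischarged d1 j chi
  | ImpI k phi _ d1 => discharge k (eq phi) (undischarged d1) j chi
  | BotC k phi d1 => discharge k (eq (Neg phi)) (undischarged d1) j chi
  | BoxI k c _ d1 => discharge k (eq (Dia (Nom c))) (undischarged d1) j chi
  | Term k a _ ds d1 =>
      fold_right (fun d' Q => undischarged d' j chi \/ Q)
        (discharge k (term_discharged a ds) (undischarged d1) j chi) ds
  | Name k a _ d1 => discharge k (eq (Nom a)) (undischarged d1) j chi
  end.

Inductive correct (P N : Type) : tree P N -> Prop :=
| correct_Assume k phi : correct (Assume k phi)
| correct_AndI phi psi d1 d2 :
    correct d1 -> concl d1 = phi ->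
    correct d2 -> concl d2 = psi ->
    correct (AndI phi psi d1 d2)
| correct_AndE1 phi psi d :
    correct d -> concl d = And phi psi ->
    correct (AndE1 phi psi d)
| correct_AndE2 phi psi d :
    correct d -> concl d = And phi psi ->
    correct (AndE2 phi psi d)
| correct_ImpI k phi psi d :
    correct d -> concl d = psi ->
    correct (ImpI k phi psi d)
| correct_ImpE phi psi d1 d2 :
    correct d1 -> concl d1 = Imp phi psi ->
    correct d2 -> concl d2 = phi ->
    correct (ImpE phi psi d1 d2)
| correct_BotC k phi d :
    correct d -> concl d = Bot ->
    is_letter phi ->
    correct (BotC k phi d)
| correct_AtI a phi d1 d2 :
    correct d1 -> concl d1 = Nom a ->
    correct d2 -> concl d2 = phi ->
    correct (AtI a phi d1 d2)
| correct_AtE a phi d1 d2 :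
    correct d1 -> concl d1 = Nom a ->
    correct d2 -> concl d2 = At a phi ->
    correct (AtE a phi d1 d2)
| correct_BoxI k c phi d :
    correct d -> concl d = At c phi ->
    ~ nom_occurs c (Box phi) ->
    (forall j chi, discharge k (eq (Dia (Nom c))) (undischarged d) j chi ->
       ~ nom_occurs c chi) ->
    correct (BoxI k c phi d)
| correct_BoxE e phi d1 d2 :
    correct d1 -> concl d1 = Box phi ->
    correct d2 -> concl d2 = Dia (Nom e) ->
    correct (BoxE e phi d1 d2)
| correct_Term k a psi ds d :
    (forall d', In d' ds -> correct d' /\ is_satisfaction (concl d')) ->
    correct d -> concl d = psi ->
    is_satisfaction psi ->
    (forall j chi, undischarged d j chi ->
       j = k /\ term_discharged a ds chi) ->
    correct (Term k a psi ds d)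
| correct_Name k a psi d :
    correct d -> concl d = psi ->
    ~ nom_occurs a psi ->
    (forall j chi, discharge k (eq (Nom a)) (undischarged d) j chi ->
       ~ nom_occurs a chi) ->
    correct (Name k a psi d).

Definition derivation (P N : Type) (Gamma : form P N -> Prop) (phi : form P N)
    (d : tree P N) : Prop :=
  correct d /\ concl d = phi /\
  forall j chi, undischarged d j chi -> Gamma chi.

Definition subformula_of_data (P N : Type) (Gamma : form P N -> Prop)
    (phi psi : form P N) : Prop :=
  subformula psi phi \/ (exists xi, Gamma xi /\ subformula psi xi).

Definition subformula_of_nominal_data (P N : Type) (psi : form P N) : Prop :=
  exists c : N, subformula psi (Nom c) \/ subformula psi (Dia (Nom c)).

(* Main.v *)
(** By compactness (ultraproducts) only finitely many premises matter, so fresh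
nominals are always available. Cuts on satisfaction statements cost nothing,
since (Term) is such a cut; it also makes @_a A derivable whenever A is derivable
from the nominal a. The calculus has no classical case analysis on compound
formulas, but it is replaced by the following stability property, proved by
induction on A: if every finite extension of C that refutes @_a A is itself
inconsistent, then @_a A is derivable from C. Applied to an underivable
@_a []A it yields, for a fresh c, a consistent extension of C containing @_a <>c
and refuting @_c A; this is the Henkin witness needed to extend C to a
saturated set, whose canonical model refutes every formula not derivable. *)

From Stdlib Require Import Classical ClassicalEpsilon PropExtensionality
  FunctionalExtensionality Arith Lia.
From mathcomp Require filter.
Require Import Defs.
Import ListNotations.

Set Implicit Arguments.
Unset Strict Implicit.

(** * Compactness *)

Section Representatives.
Context (X : Type) (E : X -> X -> Prop).
Context (E_refl : forall x, E x x) (E_sym : forall x y, E x y -> E y x).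
Context (E_trans : forall x y z, E x y -> E y z -> E x z).

(** Choosing from the class [E x], taken as a predicate, gives equivalent points the same
    representative, since by extensionality their classes are equal predicates. *)
Definition rep (x : X) : X := epsilon (inhabits x) (E x).

Lemma rep_rel x : E x (rep x).
Proof. unfold rep. apply epsilon_spec. exists x. apply E_refl. Qed.

Lemma rep_eq x y : rep x = rep y <-> E x y.
Proof.
  split.
  - intro H. apply E_trans with (rep x); [apply rep_rel|].
    rewrite H. apply E_sym, rep_rel.
  - intro H. unfold rep.
    replace (E y) with (E x).
    (* The two choices now differ only in the inhabitation proofs [inhabits x] and [inhabits y]. *)
    + f_equal. apply proof_irrelevance.
    + apply functional_extensionality. intro z. apply propositional_extensionality.
      split; eauto.
Qed.

Lemma rep_idem x : rep (rep x) = rep x.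
Proof. apply rep_eq, E_sym, rep_rel. Qed.
End Representatives.

Definition decide (Q : Prop) : bool :=
  if excluded_middle_informative Q then true else false.

Lemma decide_true Q : decide Q = true <-> Q.
Proof.
  unfold decide. destruct (excluded_middle_informative Q); split; auto; discriminate.
Qed.

(** The ultrafilter lemma of [mathcomp], restated for bare families of predicates; the last clause
    is the form in which maximality is used. *)
Lemma ultrafilter_above (I : Type) (F : (I -> Prop) -> Prop) :
  F (fun _ => True) -> ~ F (fun _ => False) ->
  (forall A B, F A -> F B -> F (fun i => A i /\ B i)) ->
  (forall A B : I -> Prop, (forall i, A i -> B i) -> F A -> F B) ->
  exists U : (I -> Prop) -> Prop,
    (forall A, F A -> U A) /\ ~ U (fun _ => False) /\
    (forall A B, U A -> U B -> U (fun i => A i /\ B i)) /\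
    (forall A B : I -> Prop, (forall i, A i -> B i) -> U A -> U B) /\
    (forall A, U A \/ U (fun i => ~ A i)).
Proof.
  intros FT F0 FI FS.
  assert (FF : filter.ProperFilter F).
  { constructor; [exact F0|]. constructor.
    - exact FT.
    - intros A B HA HB. exact (FI A B HA HB).
    - exact FS. }
  destruct (filter.ultraFilterLemma FF) as [U [HU HFU]].
  destruct (filter.ultra_proper (UltraFilter := HU)) as [U0 [UT UI US]].
  exists U. split; [exact HFU|]. split; [exact U0|].
  split; [intros A B HA HB; exact (UI A B HA HB)|].
  split; [exact US|].
  intro A. exact (filter.in_ultra_setVsetC A HU).
Qed.

(** * Ultraproducts and Łoś's theorem *)

Section Ultraproduct.
Context (P N I : Type) (M : I -> model P) (g : forall i, N -> world (M i)).
Context (U : (I -> Prop) -> Prop) (U0 : ~ U (fun _ => False)).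
Context (UI : forall A B, U A -> U B -> U (fun i => A i /\ B i)).
Context (US : forall A B : I -> Prop, (forall i, A i -> B i) -> U A -> U B).
Context (UC : forall A, U A \/ U (fun i => ~ A i)).

Let W : Type := forall i, world (M i).
Let eqU (v w : W) : Prop := U (fun i => v i = w i).

Lemma U_all (A : I -> Prop) : (forall i, A i) -> U A.
Proof.
  intro HA. destruct (UC A) as [H|H]; [exact H|].
  exfalso. apply U0. revert H. apply US. auto.
Qed.

Lemma U_not (A : I -> Prop) : U (fun i => ~ A i) <-> ~ U A.
Proof.
  split.
  - intros H1 H2. apply U0. generalize (UI H1 H2). apply US. tauto.
  - intro H. destruct (UC A); tauto.
Qed.

Lemma U_and (A B : I -> Prop) : U (fun i => A i /\ B i) <-> U A /\ U B.
Proof.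
  split.
  - intro H. split; revert H; apply US; tauto.
  - intros [HA HB]. apply UI; assumption.
Qed.

Lemma U_imp (A B : I -> Prop) : U (fun i => A i -> B i) <-> (U A -> U B).
Proof.
  split.
  - intros H HA. generalize (UI H HA). apply US. tauto.
  - intro H. destruct (classic (U A)) as [HA|HA].
    + generalize (H HA). apply US. auto.
    + apply U_not in HA. revert HA. apply US. tauto.
Qed.

Lemma eqU_refl v : eqU v v.
Proof. apply U_all. reflexivity. Qed.

Lemma eqU_sym v w : eqU v w -> eqU w v.
Proof. apply US. auto. Qed.

Lemma eqU_trans u v w : eqU u v -> eqU v w -> eqU u w.
Proof.
  intros H1 H2. generalize (UI H1 H2). apply US. intros i [E1 E2]. congruence.
Qed.

Definition canon (w : W) : W := rep eqU w.

Lemma canon_rel w : eqU w (canon w).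
Proof. unfold canon. apply rep_rel, eqU_refl. Qed.

Lemma canon_eq v w : canon v = canon w <-> eqU v w.
Proof. unfold canon. apply rep_eq; [apply eqU_refl|apply eqU_sym|apply eqU_trans]. Qed.

Lemma canon_idem w : canon (canon w) = canon w.
Proof. unfold canon. apply rep_idem; [apply eqU_refl|apply eqU_sym|apply eqU_trans]. Qed.

Lemma W_inhabited : inhabited W.
Proof. constructor. intro i. exact (epsilon (world_inhabited (M i)) (fun _ => True)). Qed.

(* Worlds are all choice functions, not their classes modulo [U]: the accessible
   ones and the denotations of nominals are the chosen representatives. *)
Definition ultraproduct : model P :=
  @Model P W W_inhabited
    (fun v w => canon w = w /\ U (fun i => acc (v i) (w i)))
    (fun w p => decide (U (fun i => val (w i) p = true))).

Definition ultra_assignment : N -> world ultraproduct :=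
  fun a => canon (fun i => g i a).

(** Łoś's theorem. The restriction to representatives serves nominals: their truth is equality of
    worlds, which between representatives amounts to equality [U]-almost everywhere. *)
Lemma sat_ultraproduct (phi : form P N) (w : W) : canon w = w ->
  (@sat P N ultraproduct ultra_assignment w phi <->
   U (fun i => sat (g i) (w i) phi)).
Proof.
  revert w. induction phi as [p|a|A IHA B IHB|A IHA B IHB| |A IHA|a A IHA];
    intros w Hw; simpl.
  - apply decide_true.
  - unfold ultra_assignment. rewrite <- Hw at 1. apply canon_eq.
  - rewrite IHA, IHB by assumption. symmetry. apply U_and.
  - rewrite IHA, IHB by assumption. symmetry. apply U_imp.
  - split; [tauto|apply U0].
  - split.
    + intro H. apply NNPP. intro HN. apply U_not in HN.
      (* Pick a refuting successor wherever the box fails, and the default [w i] elsewhere. The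
         representative of this choice agrees with it on a set of [U], so it is an accessible world
         refuting [A]. *)
      assert (Hv : forall i, exists v : world (M i),
        ~ (forall v, acc (w i) v -> sat (g i) v A) -> acc (w i) v /\ ~ sat (g i) v A).
      { intro i. destruct (classic (forall v, acc (w i) v -> sat (g i) v A)) as [Hi|Hi].
        - exists (w i). tauto.
        - apply not_all_ex_not in Hi. destruct Hi as [v Hi].
          exists v. intros _. tauto. }
      set (v := fun i => proj1_sig (constructive_indefinite_description _ (Hv i))).
      assert (Hv' : forall i, ~ (forall v, acc (w i) v -> sat (g i) v A) ->
                acc (w i) (v i) /\ ~ sat (g i) (v i) A).
      { intro i. unfold v. destruct constructive_indefinite_description. exact a. }
      assert (HvU := canon_rel v). unfold eqU in HvU.
      generalize (UI HvU HN). intro HvN.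
      assert (Hc := canon_idem v).
      assert (HA : U (fun i => sat (g i) (canon v i) A)).
      { apply IHA; [exact Hc|]. apply H. split; [exact Hc|].
        revert HvN. apply US. intros i [E HNi]. rewrite <- E. apply Hv', HNi. }
      apply U0. generalize (UI HvN HA). apply US. intros i [[E HNi] HAi].
      rewrite <- E in HAi. apply (Hv' i HNi), HAi.
    + intros H v [Hv Hacc]. apply IHA; [exact Hv|].
      generalize (UI H Hacc). apply US. intros i [H1 H2]. auto.
  - rewrite IHA by apply canon_idem. unfold ultra_assignment.
    assert (HU := canon_rel (fun i => g i a)). unfold eqU in HU.
    split; intro H; generalize (UI HU H); apply US; intros i [E Hi].
    + rewrite E. exact Hi.
    + rewrite <- E. exact Hi.
Qed.
End Ultraproduct.

(** The indices are the finite lists from [Gamma], and the ultrafilter extends the filter generated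
    by the cones of lists including a given one. Each [xi] holds throughout the cone of [[xi]],
    hence in the ultraproduct. *)
Lemma compactness (P N : Type) (Gamma : form P N -> Prop) :
  (forall l, (forall xi, In xi l -> Gamma xi) ->
     exists (M : model P) (g : N -> world M) (w : world M),
       forall xi, In xi l -> sat g w xi) ->
  exists (M : model P) (g : N -> world M) (w : world M),
    forall xi, Gamma xi -> sat g w xi.
Proof.
  intro Hfin.
  set (I := {l : list (form P N) | forall xi, In xi l -> Gamma xi}).
  assert (HM : forall i : I, exists x : {M : model P & (N -> world M) * world M}%type,
     forall xi, In xi (proj1_sig i) ->
       sat (fst (projT2 x)) (snd (projT2 x)) xi).
  { intros [l Hl]. destruct (Hfin l Hl) as [M [g [w H]]].
    exists (existT _ M (g, w)). exact H. }
  set (x := fun i => proj1_sig (constructive_indefinite_description _ (HM i))).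
  assert (Hx : forall i xi, In xi (proj1_sig i) ->
       sat (fst (projT2 (x i))) (snd (projT2 (x i))) xi).
  { intro i. unfold x. destruct constructive_indefinite_description. assumption. }
  destruct (@ultrafilter_above I
    (fun A => exists i0 : I, forall i : I, incl (proj1_sig i0) (proj1_sig i) -> A i))
    as [U [UF [U0 [UI [US UC]]]]].
  - assert (Hnil : forall xi, In xi [] -> Gamma xi) by (intros xi []).
    exists (exist _ [] Hnil). auto.
  - intros [i0 H]. apply (H i0). apply incl_refl.
  - intros A B [[l Hl] HA] [[m Hm] HB].
    assert (Hlm : forall xi, In xi (l ++ m) -> Gamma xi).
    { intros xi H. apply in_app_or in H. destruct H; auto. }
    exists (exist _ (l ++ m) Hlm). intros i Hi. simpl in Hi.
    split; [apply HA|apply HB]; intros xi H; apply Hi, in_or_app; auto.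
  - intros A B HAB [i0 HA]. exists i0. auto.
  - set (M := fun i => projT1 (x i)).
    set (g := fun i => fst (projT2 (x i)) : N -> world (M i)).
    set (w := fun i => snd (projT2 (x i)) : world (M i)).
    exists (ultraproduct M U), (ultra_assignment g U), (canon U w).
    intros xi Hxi. apply sat_ultraproduct; auto.
    { apply canon_idem; auto. }
    assert (Hs : forall xi', In xi' [xi] -> Gamma xi').
    { intros xi' [<-|[]]. exact Hxi. }
    assert (HU : U (fun i => sat (g i) (w i) xi)).
    { apply UF. exists (exist _ [xi] Hs). intros i Hi. apply Hx, Hi. left. reflexivity. }
    generalize (UI _ _ (canon_rel U0 US UC w) HU). apply US.
    intros i [E Hi]. rewrite <- E. exact Hi.
Qed.

(** * Derivations within a set of formulas *)

(** Unfolds the (Term) clauses of [occurs] and [undischarged]. *)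
Lemma fold_right_or (X : Type) (Q : X -> Prop) (Q0 : Prop) (l : list X) :
  fold_right (fun x R => Q x \/ R) Q0 l <-> Q0 \/ exists x, In x l /\ Q x.
Proof.
  induction l as [|x l IH]; simpl.
  - firstorder.
  - rewrite IH. split.
    + intros [H|[H|[y [H1 H2]]]]; eauto.
    + intros [H|[y [[->|H1] H2]]]; eauto.
Qed.

Lemma discharge_cons (P N : Type) (A : form P N) (C : list (form P N))
    (D : form P N -> Prop) (H : nat -> form P N -> Prop) :
  (forall j chi, H j chi -> j = 0 /\ In chi (A :: C)) -> D A ->
  forall j chi, discharge 0 D H j chi -> j = 0 /\ In chi C.
Proof.
  intros HH HD j chi [H1 H2]. destruct (HH _ _ H1) as [-> [<-|H3]]; tauto.
Qed.

Section Analytic.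
(** [L] abstracts the formulas permitted without a label. Negations are demanded only for letters,
    as (⊥) discharges no others; that of a nominal is a subformula of [Dia (Nom a)]. *)
Context (P N : Type) (L : form P N -> Prop).
Context (L_and : forall A B, L (And A B) -> L A /\ L B).
Context (L_imp : forall A B, L (Imp A B) -> L A /\ L B).
Context (L_box : forall A, L (Box A) -> L A).
Context (L_at : forall a A, L (At a A) -> L A).
Context (L_nom : forall a, L (Nom a)).
Context (L_dia : forall a, L (Dia (Nom a))).
Context (L_neg : forall p, L (Prp p) -> L (Neg (Prp p))).
Context (L_bot : L Bot).

Definition allowed (theta : form P N) : Prop :=
  L theta \/ exists a psi, theta = At a psi /\ L psi.

(* All annotations are [0], so that an assumption is identified by its formula
   and contexts can be treated as finite sets. *)
Definition prov (C : list (form P N)) (theta : form P N) : Prop :=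
  exists d, correct d /\ concl d = theta /\
    (forall j chi, undischarged d j chi -> j = 0 /\ In chi C) /\
    (forall chi, occurs chi d -> allowed chi).

Lemma allowed_L A : L A -> allowed A.
Proof. left. assumption. Qed.

Lemma allowed_at a A : L A -> allowed (At a A).
Proof. right. eauto. Qed.

Lemma L_negnom a : L (Neg (Nom a)).
Proof. exact (L_box (proj1 (L_imp (L_dia a)))). Qed.

Lemma prov_hyp C A : In A C -> allowed A -> prov C A.
Proof.
  intros HC HA. exists (Assume 0 A). split; [constructor|]. split; [reflexivity|].
  split; simpl.
  - intros j chi [-> ->]. auto.
  - intros chi [->|[]]. exact HA.
Qed.

Lemma prov_weaken C C' A : incl C C' -> prov C A -> prov C' A.
Proof.
  intros HC [d [H1 [H2 [H3 H4]]]]. exists d. repeat split; auto.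
  - apply (H3 _ _ H).
  - apply HC, (H3 _ _ H).
Qed.

Lemma prov_allowed C A : prov C A -> allowed A.
Proof.
  intros [d [_ [<- [_ H]]]]. apply H. destruct d; left; reflexivity.
Qed.

Lemma prov_andI C A B : L (And A B) -> prov C A -> prov C B -> prov C (And A B).
Proof.
  intros HL [d1 [A1 [A2 [A3 A4]]]] [d2 [B1 [B2 [B3 B4]]]].
  exists (AndI A B d1 d2). split; [constructor; auto|]. split; [reflexivity|].
  split; simpl.
  - intros j chi [H|H]; auto.
  - intros chi [->|[H|H]]; auto. apply allowed_L, HL.
Qed.

Lemma prov_andE1 C A B : L A -> prov C (And A B) -> prov C A.
Proof.
  intros HL [d1 [A1 [A2 [A3 A4]]]].
  exists (AndE1 A B d1). split; [constructor; auto|]. split; [reflexivity|].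
  split; simpl; auto.
  intros chi [->|H]; auto. apply allowed_L, HL.
Qed.

Lemma prov_andE2 C A B : L B -> prov C (And A B) -> prov C B.
Proof.
  intros HL [d1 [A1 [A2 [A3 A4]]]].
  exists (AndE2 A B d1). split; [constructor; auto|]. split; [reflexivity|].
  split; simpl; auto.
  intros chi [->|H]; auto. apply allowed_L, HL.
Qed.

Lemma prov_impI C A B : L (Imp A B) -> prov (A :: C) B -> prov C (Imp A B).
Proof.
  intros HL [d1 [A1 [A2 [A3 A4]]]].
  exists (ImpI 0 A B d1). split; [constructor; auto|]. split; [reflexivity|].
  split; simpl.
  - apply (discharge_cons A3). reflexivity.
  - intros chi [->|H]; auto. apply allowed_L, HL.
Qed.

Lemma prov_impE C A B : L B -> prov C (Imp A B) -> prov C A -> prov C B.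
Proof.
  intros HL [d1 [A1 [A2 [A3 A4]]]] [d2 [B1 [B2 [B3 B4]]]].
  exists (ImpE A B d1 d2). split; [constructor; auto|]. split; [reflexivity|].
  split; simpl.
  - intros j chi [H|H]; auto.
  - intros chi [->|[H|H]]; auto. apply allowed_L, HL.
Qed.

Lemma prov_botC C A : is_letter A -> L A -> prov (Neg A :: C) Bot -> prov C A.
Proof.
  intros HA HL [d1 [A1 [A2 [A3 A4]]]].
  exists (BotC 0 A d1). split; [constructor; auto|]. split; [reflexivity|].
  split; simpl.
  - apply (discharge_cons A3). reflexivity.
  - intros chi [->|H]; auto. apply allowed_L, HL.
Qed.

Lemma prov_atI C a A : L A -> prov C (Nom a) -> prov C A -> prov C (At a A).
Proof.
  intros HL [d1 [A1 [A2 [A3 A4]]]] [d2 [B1 [B2 [B3 B4]]]].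
  exists (AtI a A d1 d2). split; [constructor; auto|]. split; [reflexivity|].
  split; simpl.
  - intros j chi [H|H]; auto.
  - intros chi [->|[H|H]]; auto. apply allowed_at, HL.
Qed.

Lemma prov_atE C a A : L A -> prov C (Nom a) -> prov C (At a A) -> prov C A.
Proof.
  intros HL [d1 [A1 [A2 [A3 A4]]]] [d2 [B1 [B2 [B3 B4]]]].
  exists (AtE a A d1 d2). split; [constructor; auto|]. split; [reflexivity|].
  split; simpl.
  - intros j chi [H|H]; auto.
  - intros chi [->|[H|H]]; auto. apply allowed_L, HL.
Qed.

Lemma prov_boxI C c A : L (Box A) ->
  (forall chi, In chi (Box A :: C) -> ~ nom_occurs c chi) ->
  prov (Dia (Nom c) :: C) (At c A) -> prov C (Box A).
Proof.
  intros HL Hc [d1 [A1 [A2 [A3 A4]]]].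
  assert (HD := discharge_cons A3 (eq_refl (Dia (Nom c)))).
  exists (BoxI 0 c A d1). split.
  - constructor; auto.
    + apply Hc. left. reflexivity.
    + intros j chi H. apply Hc. right. apply (HD _ _ H).
  - split; [reflexivity|]. split; simpl; [exact HD|].
    intros chi [->|H]; auto. apply allowed_L, HL.
Qed.

Lemma prov_boxE C e A : L A -> prov C (Box A) -> prov C (Dia (Nom e)) ->
  prov C (At e A).
Proof.
  intros HL [d1 [A1 [A2 [A3 A4]]]] [d2 [B1 [B2 [B3 B4]]]].
  exists (BoxE e A d1 d2). split; [constructor; auto|]. split; [reflexivity|].
  split; simpl.
  - intros j chi [H|H]; auto.
  - intros chi [->|[H|H]]; auto. apply allowed_at, HL.
Qed.

(** (Term) as a cut: [C'] is proved from [C], and the last premise sees only [C'] and the nominal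
    [a]. *)
Lemma prov_term C C' a psi :
  (forall chi, In chi C' -> is_satisfaction chi /\ prov C chi) ->
  is_satisfaction psi -> prov (Nom a :: C') psi -> prov C psi.
Proof.
  intros HC Hpsi Hprov.
  assert (Hal := prov_allowed Hprov).
  destruct Hprov as [d1 [A1 [A2 [A3 A4]]]].
  (* One derivation per formula of [C'], so that the formulas discharged by (Term) are exactly
     [Nom a] and those of [C']. *)
  assert (Hds : exists ds, map (@concl P N) ds = C' /\
    forall d, In d ds -> correct d /\
     (forall j chi, undischarged d j chi -> j = 0 /\ In chi C) /\
     (forall chi, occurs chi d -> allowed chi)).
  { clear - HC. induction C' as [|chi C' IH].
    - exists []. split; [reflexivity|intros d []].
    - destruct IH as [ds [H1 H2]].
      { intros chi' H. apply HC. right. exact H. }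
      destruct (HC chi (or_introl eq_refl)) as [_ [d [B1 [B2 [B3 B4]]]]].
      exists (d :: ds). split; [simpl; congruence|].
      intros d' [<-|H]; auto. }
  destruct Hds as [ds [E Hds]].
  exists (Term 0 a psi ds d1). split; [|split; [reflexivity|split]].
  - constructor; auto.
    + intros d' H. split; [apply Hds, H|]. apply HC. rewrite <- E. apply in_map, H.
    + intros j chi H. destruct (A3 _ _ H) as [H1 H2]. split; [exact H1|].
      unfold term_discharged. rewrite E. destruct H2; auto.
  - intros j chi H. simpl in H. apply fold_right_or in H.
    destruct H as [[H1 H2]|[d [H1 H2]]].
    + exfalso. destruct (A3 _ _ H1) as [H3 H4]. apply H2. split; [exact H3|].
      unfold term_discharged. rewrite E. destruct H4; auto.
    + apply (Hds d H1), H2.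
  - intros chi [->|H]; [exact Hal|]. apply fold_right_or in H.
    destruct H as [H|[d [H1 H2]]]; auto. apply (Hds d H1), H2.
Qed.

Lemma prov_name C a psi :
  (forall chi, In chi (psi :: C) -> ~ nom_occurs a chi) ->
  prov (Nom a :: C) psi -> prov C psi.
Proof.
  intros Ha Hprov. assert (Hal := prov_allowed Hprov).
  destruct Hprov as [d1 [A1 [A2 [A3 A4]]]].
  assert (HD := discharge_cons A3 (eq_refl (Nom a))).
  exists (Name 0 a psi d1). split.
  - constructor; auto.
    + apply Ha. left. reflexivity.
    + intros j chi H. apply Ha. right. apply (HD _ _ H).
  - split; [reflexivity|]. split; simpl; [exact HD|].
    intros chi [->|H]; auto.
Qed.

(** * Reasoning with satisfaction statements *)

(** Satisfaction statements are the premises that (Term) can carry from one world to another. *)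
Definition labelled (C : list (form P N)) : Prop :=
  forall chi, In chi C -> exists a psi, chi = At a psi /\ L psi.

Lemma labelled_nil : labelled [].
Proof. intros chi []. Qed.

Lemma labelled_cons a A C : L A -> labelled C -> labelled (At a A :: C).
Proof. intros HA HC chi [<-|H]; eauto. Qed.

Lemma labelled_allowed C chi : labelled C -> In chi C -> allowed chi.
Proof. intros HC H. right. apply HC, H. Qed.

Lemma labelled_satisfaction C chi : labelled C -> In chi C -> is_satisfaction chi.
Proof. intros HC H. destruct (HC chi H) as [a [psi [E _]]]. exists a, psi. exact E. Qed.

(** Under the assumption [a], (@I) turns [A] into [At a A]; (Term) then discharges [a], with [C]
    handed through as its own premises. *)
Lemma prov_local C a A : labelled C -> L A ->
  prov (Nom a :: C) A -> prov C (At a A).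
Proof.
  intros HC HA H. apply prov_term with (a := a) (C' := C).
  - intros chi Hchi. split; [eapply labelled_satisfaction; eauto|].
    apply prov_hyp; [exact Hchi|]. eapply labelled_allowed; eauto.
  - exists a, A. reflexivity.
  - apply prov_atI; auto. apply prov_hyp; [left; reflexivity|apply allowed_L; auto].
Qed.

Lemma prov_cut C C' a A : labelled C' -> (forall chi, In chi C' -> prov C chi) ->
  prov C' (At a A) -> prov C (At a A).
Proof.
  intros HC HCC H. apply prov_term with (a := a) (C' := C').
  - intros chi Hchi. split; [eapply labelled_satisfaction; eauto|auto].
  - exists a, A. reflexivity.
  - revert H. apply prov_weaken. intro. simpl. auto.
Qed.

Ltac hyp := apply prov_hyp; [simpl; tauto|auto using allowed_L, allowed_at].
Ltac atE_hyp a := apply prov_atE with a; [auto|hyp|hyp].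

(** In a local context [D] containing [a], the plain assumption [A] yields [At a A] by (@I), and the
    resulting [At a B] yields [B] by (@E). This lets (→I) and (⊥) discharge unlabelled formulas on
    behalf of labelled ones. *)
Lemma prov_at_hyp C a A B D : labelled (At a A :: C) ->
  In (Nom a) D -> In A D -> incl C D -> L B ->
  prov (At a A :: C) (At a B) -> prov D B.
Proof.
  intros HC Ha HA HCD HB H.
  assert (HLA : L A).
  { destruct (HC (At a A) (or_introl eq_refl)) as [b [psi [E HL]]].
    injection E as _ ->. exact HL. }
  apply prov_atE with a; [exact HB|apply prov_hyp; auto using allowed_L|].
  apply prov_cut with (At a A :: C); [exact HC| |exact H].
  intros chi [<-|Hchi].
  - apply prov_atI; [exact HLA| |]; apply prov_hyp; auto using allowed_L.
  - apply prov_hyp; [auto|]. eapply labelled_allowed; [exact HC|right; exact Hchi].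
Qed.

(** * Labelled forms of the rules *)

Lemma at_impI C a A B : labelled C -> L (Imp A B) ->
  prov (At a A :: C) (At a B) -> prov C (At a (Imp A B)).
Proof.
  intros HC HL H. destruct (L_imp HL) as [HA HB].
  apply prov_local; auto. apply prov_impI; auto.
  apply prov_at_hyp with C a A; simpl; auto using labelled_cons.
  intro. simpl. auto.
Qed.

Lemma at_letter C a A : labelled C -> is_letter A -> L A -> L (Neg A) ->
  prov (At a (Neg A) :: C) (At a Bot) -> prov C (At a A).
Proof.
  intros HC HA HL HN H.
  apply prov_local; auto. apply prov_botC; auto.
  apply prov_at_hyp with C a (Neg A); simpl; auto using labelled_cons.
  intro. simpl. auto.
Qed.

(** The nominal [c] must also differ from [a], because the assumption [a] is still open when (□I) is
    applied inside (Term). *)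
Lemma at_boxI C a c A : labelled C -> L (Box A) ->
  (forall chi, In chi (Box A :: Nom a :: C) -> ~ nom_occurs c chi) ->
  prov (At a (Dia (Nom c)) :: C) (At c A) -> prov C (At a (Box A)).
Proof.
  intros HC HL Hc H.
  apply prov_local; auto. apply prov_boxI with c; auto.
  apply prov_cut with (At a (Dia (Nom c)) :: C); auto using labelled_cons.
  intros chi [<-|Hchi].
  - apply prov_atI; auto; hyp.
  - apply prov_hyp; [simpl; auto|]. eapply labelled_allowed; eauto.
Qed.

Lemma at_andI a A B : L (And A B) ->
  prov [At a A; At a B] (At a (And A B)).
Proof.
  intros HL. destruct (L_and HL) as [HA HB].
  apply prov_local; auto using labelled_cons, labelled_nil.
  apply prov_andI; auto; atE_hyp a.
Qed.

Lemma at_andE1 a A B : L (And A B) -> prov [At a (And A B)] (At a A).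
Proof.
  intros HL. destruct (L_and HL) as [HA HB].
  apply prov_local; auto using labelled_cons, labelled_nil.
  apply prov_andE1 with B; auto. atE_hyp a.
Qed.

Lemma at_andE2 a A B : L (And A B) -> prov [At a (And A B)] (At a B).
Proof.
  intros HL. destruct (L_and HL) as [HA HB].
  apply prov_local; auto using labelled_cons, labelled_nil.
  apply prov_andE2 with A; auto. atE_hyp a.
Qed.

Lemma at_impE a A B : L (Imp A B) -> prov [At a (Imp A B); At a A] (At a B).
Proof.
  intros HL. destruct (L_imp HL) as [HA HB].
  apply prov_local; auto using labelled_cons, labelled_nil.
  apply prov_impE with A; auto; atE_hyp a.
Qed.

(** The conclusion carries the label [e] while the reasoning takes place at [a], so (Term) is
    applied directly and not through [prov_local]. *)
Lemma at_boxE a e A : L (Box A) ->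
  prov [At a (Box A); At a (Dia (Nom e))] (At e A).
Proof.
  intros HL. assert (HA := L_box HL).
  apply prov_term with (a := a) (C' := [At a (Box A); At a (Dia (Nom e))]).
  - intros chi Hchi. split.
    + destruct Hchi as [<-|[<-|[]]]; eexists; eexists; reflexivity.
    + destruct Hchi as [<-|[<-|[]]]; hyp.
  - eexists; eexists; reflexivity.
  - apply prov_boxE; auto; atE_hyp a.
Qed.

Lemma at_atI a b A : L (At b A) -> prov [At b A] (At a (At b A)).
Proof.
  intros HL. assert (HA := L_at HL).
  apply prov_local; auto using labelled_cons, labelled_nil. hyp.
Qed.

Lemma at_atE a b A : L (At b A) -> prov [At a (At b A)] (At b A).
Proof.
  intros HL. assert (HA := L_at HL).
  apply prov_term with (a := a) (C' := [At a (At b A)]).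
  - intros chi Hchi. split.
    + destruct Hchi as [<-|[]]; eexists; eexists; reflexivity.
    + destruct Hchi as [<-|[]]; hyp.
  - eexists; eexists; reflexivity.
  - apply prov_atE with a; [auto|hyp|hyp].
Qed.

Lemma at_refl a : prov [] (At a (Nom a)).
Proof. apply prov_local; auto using labelled_nil. hyp. Qed.

(** At the world named [a] both [b] and [A] hold, so (@I) applies. Symmetry and transitivity of
    equality between nominals come from this rule. *)
Lemma at_transport a b A : L A -> prov [At a (Nom b); At a A] (At b A).
Proof.
  intros HL.
  apply prov_term with (a := a) (C' := [At a (Nom b); At a A]).
  - intros chi Hchi. split.
    + destruct Hchi as [<-|[<-|[]]]; eexists; eexists; reflexivity.
    + destruct Hchi as [<-|[<-|[]]]; hyp.
  - eexists; eexists; reflexivity.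
  - apply prov_atI; auto; atE_hyp a.
Qed.

(** Assume [Box (Neg (Nom c))] at [a]. With [Dia (Nom b)] it gives [Neg (Nom c)] at [b], where [c]
    holds; the contradiction at [b] is then moved back to [a]. *)
Lemma at_dia_transport a b c :
  prov [At b (Nom c); At a (Dia (Nom b))] (At a (Dia (Nom c))).
Proof.
  assert (Hbox := fun c => proj1 (L_imp (L_dia c))).
  assert (Hneg := L_negnom).
  apply at_impI; [auto using labelled_cons, labelled_nil|exact (L_dia c)|].
  apply prov_cut with [At b Bot]; auto using labelled_cons, labelled_nil.
  - intros chi [<-|[]].
    apply prov_cut with [At b (Neg (Nom c)); At b (Nom c)];
      auto using labelled_cons, labelled_nil.
    + intros chi [<-|[<-|[]]].
      * apply prov_cut with [At a (Box (Neg (Nom c))); At a (Dia (Nom b))];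
          auto using labelled_cons, labelled_nil, at_boxE.
        intros chi [<-|[<-|[]]]; hyp.
      * hyp.
    + apply at_impE. apply Hneg.
  - apply prov_term with (a := b) (C' := [At b Bot]).
    + intros chi [<-|[]]. split; [eexists; eexists; reflexivity|hyp].
    + eexists; eexists; reflexivity.
    + apply prov_atI; auto; [|atE_hyp b].
      apply prov_botC; auto; [right; eauto|]. atE_hyp b.
Qed.

(** * Inconsistent contexts *)

Definition inconsistent (C : list (form P N)) : Prop :=
  exists a, prov C (At a Bot).

(** Falsum at [a] proves the nominal [b] there by (⊥), nominals being letters; (@I) then gives
    falsum at [b]. *)
Lemma inconsistent_at C b : inconsistent C -> prov C (At b Bot).
Proof.
  intros [a H]. apply prov_term with (a := a) (C' := [At a Bot]).
  - intros chi [<-|[]]. split; [eexists; eexists; reflexivity|exact H].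
  - eexists; eexists; reflexivity.
  - apply prov_atI; auto; [|atE_hyp a].
    apply prov_botC; auto; [right; eauto|]. atE_hyp a.
Qed.

Lemma inconsistent_incl C C' : incl C C' -> inconsistent C -> inconsistent C'.
Proof. intros HC [a H]. exists a. revert H. apply prov_weaken, HC. Qed.

Lemma inconsistent_cut C C' : labelled C' ->
  (forall chi, In chi C' -> prov C chi) -> inconsistent C' -> inconsistent C.
Proof. intros HC HCC [a H]. exists a. revert H. apply prov_cut; auto. Qed.

Lemma inconsistent_step C chi : labelled (chi :: C) -> prov C chi ->
  inconsistent (chi :: C) -> inconsistent C.
Proof.
  intros HC H. apply inconsistent_cut; [exact HC|].
  intros x [<-|Hx]; [exact H|]. apply prov_hyp; [exact Hx|].
  apply labelled_allowed with (1 := HC). right. exact Hx.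
Qed.

(** * Completeness for countable sets of formulas *)

Context (f : nat -> N) (f_inj : forall m n, f m = f n -> m = n)
  (f_surj : forall a, exists n, f n = a).

Lemma fresh_form (A : form P N) :
  exists n, forall m, n <= m -> ~ nom_occurs (f m) A.
Proof.
  induction A as [p|a|A [i IHA] B [j IHB]|A [i IHA] B [j IHB]| |A [i IHA]|a A [i IHA]];
    simpl.
  - exists 0. tauto.
  - destruct (f_surj a) as [n <-]. exists (S n). intros m Hm E.
    apply f_inj in E. lia.
  - exists (i + j). intros m Hm [H|H]; [apply (IHA m)|apply (IHB m)]; auto; lia.
  - exists (i + j). intros m Hm [H|H]; [apply (IHA m)|apply (IHB m)]; auto; lia.
  - exists 0. tauto.
  - exists i. exact IHA.
  - destruct (f_surj a) as [n <-]. exists (S n + i). intros m Hm [E|H].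
    + apply f_inj in E. lia.
    + apply (IHA m); auto; lia.
Qed.

Lemma fresh_list (C : list (form P N)) :
  exists c, forall chi, In chi C -> ~ nom_occurs c chi.
Proof.
  assert (H : exists n, forall m, n <= m -> forall chi, In chi C ->
            ~ nom_occurs (f m) chi).
  { induction C as [|A C [i IH]].
    - exists 0. intros m _ chi [].
    - destruct (fresh_form A) as [j Hj]. exists (i + j).
      intros m Hm chi [<-|H]; [apply Hj|apply IH with (2 := H)]; lia. }
  destruct H as [n H]. exists (f n). apply H. lia.
Qed.

(* Only letters admit proof by contradiction in the calculus; this is its
   extension to all formulas without forming the negation of [A]: refutability
   of [A] in an extended context plays the role of the hypothesis [Neg A]. *)
Lemma stability A : L A -> forall C a, labelled C ->
  (forall C', labelled C' -> incl C C' ->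
     inconsistent (At a A :: C') -> inconsistent C') ->
  prov C (At a A).
Proof.
  induction A as [p|b|A IHA B IHB|A IHA B IHB| |A IHA|b A IHA];
    intros HL C a HC H.
  (* (⊥) adds the negation of the letter at [a]. That extension refutes the letter, so by hypothesis
     it is inconsistent. *)
  - apply at_letter; auto; [left; eauto|].
    apply inconsistent_at. apply H; [auto using labelled_cons|intro; simpl; auto|].
    exists a. apply prov_weaken with [At a (Imp (Prp p) Bot); At a (Prp p)];
      auto using labelled_cons.
    + intro. simpl. tauto.
    + apply at_impE, L_neg, HL.
  - apply at_letter; auto; [right; eauto|apply L_negnom|].
    apply inconsistent_at.
    apply H; [auto using labelled_cons, L_negnom|intro; simpl; auto|].
    exists a. apply prov_weaken with [At a (Imp (Nom b) Bot); At a (Nom b)];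
      auto using labelled_cons, L_negnom.
    + intro. simpl. tauto.
    + apply at_impE, L_negnom.
  - destruct (L_and HL) as [HA HB].
    assert (PA : prov C (At a A)).
    { apply IHA; auto. intros C' HC' HCC' Hi. apply H; auto.
      apply inconsistent_step with (At a A); auto using labelled_cons.
      - apply prov_weaken with [At a (And A B)]; [|apply at_andE1; exact HL].
        intro. simpl. tauto.
      - revert Hi. apply inconsistent_incl. intro. simpl. tauto. }
    assert (PB : prov C (At a B)).
    { apply IHB; auto. intros C' HC' HCC' Hi. apply H; auto.
      apply inconsistent_step with (At a B); auto using labelled_cons.
      - apply prov_weaken with [At a (And A B)]; [|apply at_andE2; exact HL].
        intro. simpl. tauto.
      - revert Hi. apply inconsistent_incl. intro. simpl. tauto. }
    apply prov_cut with [At a A; At a B]; auto using labelled_cons, labelled_nil.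
    + intros chi [<-|[<-|[]]]; auto.
    + apply at_andI, HL.
  (* In an extension containing [At a A], the implication yields [At a B]; refuting the latter
     therefore refutes the former. *)
  - destruct (L_imp HL) as [HA HB]. apply at_impI; auto.
    apply IHB; auto using labelled_cons. intros C' HC' HCC' Hi.
    apply H; auto; [intros x Hx; apply HCC'; right; exact Hx|].
    apply inconsistent_step with (At a B); auto using labelled_cons.
    + apply prov_weaken with [At a (Imp A B); At a A]; [|apply at_impE; exact HL].
      intros x [<-|[<-|[]]]; [left; reflexivity|right; apply HCC'; left; reflexivity].
    + revert Hi. apply inconsistent_incl. intro. simpl. tauto.
  - apply inconsistent_at. apply H; [exact HC|apply incl_refl|].
    exists a. apply prov_hyp; [left; reflexivity|apply allowed_at, L_bot].
  - assert (HA := L_box HL).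
    (* Once [At a (Dia (Nom c))] is in the context, [At a (Box A)] yields [At c A], so any
       refutation of [At c A] there refutes the box. *)
    destruct (fresh_list (Box A :: Nom a :: C)) as [c Hc].
    apply at_boxI with c; auto. apply IHA; auto using labelled_cons.
    intros C' HC' HCC' Hi.
    apply H; auto; [intros x Hx; apply HCC'; right; exact Hx|].
    apply inconsistent_step with (At c A); auto using labelled_cons.
    + apply prov_weaken with [At a (Box A); At a (Dia (Nom c))];
        [|apply at_boxE; exact HL].
      intros x [<-|[<-|[]]]; [left; reflexivity|right; apply HCC'; left; reflexivity].
    + revert Hi. apply inconsistent_incl. intro. simpl. tauto.
  - assert (HA := L_at HL).
    apply prov_cut with [At b A]; auto using labelled_cons, labelled_nil, at_atI.
    intros chi [<-|[]]. apply IHA; auto. intros C' HC' HCC' Hi. apply H; auto.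
    apply inconsistent_step with (At b A); auto using labelled_cons.
    + apply prov_weaken with [At a (At b A)]; [|apply at_atE; exact HL].
      intro. simpl. tauto.
    + revert Hi. apply inconsistent_incl. intro. simpl. tauto.
Qed.

(** All extensions of [C] are inconsistent, so [stability] applies; (⊥) by itself concludes only
    letters. *)
Lemma exfalso C a A : L A -> labelled C -> inconsistent C -> prov C (At a A).
Proof.
  intros HL HC H. apply stability; auto. intros C' _ HCC' _.
  revert H. apply inconsistent_incl, HCC'.
Qed.

(** * Saturated sets *)

Definition good (C : list (form P N)) : Prop := labelled C /\ ~ inconsistent C.

(* The last clause supplies a witness against a box that has been refuted. *)
Definition decided (C : list (form P N)) (theta : form P N) : Prop :=
  forall a A, theta = At a A -> L A ->
    In theta C \/
    inconsistent (theta :: C) /\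
    forall B, A = Box B -> exists c,
      In (At a (Dia (Nom c))) C /\ inconsistent (At c B :: C).

Lemma decided_incl C C' theta : incl C C' -> decided C theta -> decided C' theta.
Proof.
  intros HC H a A E HL. destruct (H a A E HL) as [H1|[H1 H2]]; [left; auto|right].
  assert (HC' : forall x, incl (x :: C) (x :: C')).
  { intros x y [<-|Hy]; simpl; auto. }
  split; [revert H1; apply inconsistent_incl, HC'|].
  intros B EB. destruct (H2 B EB) as [c [H3 H4]]. exists c.
  split; [auto|]. revert H4. apply inconsistent_incl, HC'.
Qed.

Lemma decide_one C theta : good C ->
  exists C', good C' /\ incl C C' /\ decided C' theta.
Proof.
  intros [HC Hcon].
  destruct (classic (exists a A, theta = At a A /\ L A)) as [[a [A [-> HL]]]|Hno].
  2:{ exists C. split; [split; assumption|]. split; [apply incl_refl|].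
      intros a A E HL. exfalso. eauto. }
  destruct (classic (inconsistent (At a A :: C))) as [Hi|Hi].
  2:{ exists (At a A :: C). split; [split; auto using labelled_cons|].
      split; [intro; simpl; auto|]. intros a' A' _ _. left. left. reflexivity. }
  destruct (classic (exists B, A = Box B)) as [[B ->]|Hno].
  2:{ exists C. split; [split; assumption|]. split; [apply incl_refl|].
      intros a' A' E _. right. split; [exact Hi|].
      injection E as <- <-. intros B EB. exfalso. eauto. }
  assert (HB := L_box HL).
  destruct (fresh_list (Box B :: Nom a :: C)) as [c Hc].
  destruct (classic (exists C', good C' /\ incl (At a (Dia (Nom c)) :: C) C' /\
              inconsistent (At c B :: C'))) as [[C' [H1 [H2 H3]]]|Hno].
  - exists C'. split; [exact H1|].
    assert (HCC' : incl C C') by (intros x Hx; apply H2; right; exact Hx).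
    split; [exact HCC'|]. intros a' A' E _. right.
    injection E as <- <-. split.
    + revert Hi. apply inconsistent_incl. intros x [<-|Hx]; simpl; auto.
    + intros B' E. injection E as <-. exists c. split; [|exact H3].
      apply H2. left. reflexivity.
  (* Without such a [C'], every extension of [At a (Dia (Nom c)) :: C] that refutes [At c B] is
     inconsistent. Then [stability] proves [At c B], and [at_boxI] proves the box, which [Hi]
     refutes. *)
  - exfalso. apply Hcon. apply inconsistent_step with (At a (Box B));
      auto using labelled_cons.
    apply at_boxI with c; auto. apply stability; auto using labelled_cons.
    intros C' HC' HCC' Hi'. apply NNPP. intro Hcon'. apply Hno.
    exists C'. split; [split; assumption|]. auto.
Qed.

Lemma decide_list l : forall C, good C ->
  exists C', good C' /\ incl C C' /\ forall theta, In theta l -> decided C' theta.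
Proof.
  induction l as [|theta l IH]; intros C HC.
  - exists C. split; [exact HC|]. split; [apply incl_refl|]. intros theta [].
  - destruct (decide_one theta HC) as [C1 [H1 [H2 H3]]].
    destruct (IH C1 H1) as [C2 [H4 [H5 H6]]].
    exists C2. split; [exact H4|]. split; [eapply incl_tran; eauto|].
    intros theta' [<-|H]; auto. apply decided_incl with C1; auto.
Qed.

Context (E : nat -> list (form P N)).
Context (E_exhausts : forall A, L A -> exists n, In A (E n)).

(** Dovetails the nominals with the enumeration [E]: each stage is finite, and every satisfaction
    statement over [L] turns up in some stage. *)
Definition stage (n : nat) : list (form P N) :=
  flat_map (fun i => map (At (f i)) (flat_map E (seq 0 (S n)))) (seq 0 (S n)).

Lemma stage_exhausts a A : L A -> exists n, In (At a A) (stage n).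
Proof.
  intro HL. destruct (f_surj a) as [i <-]. destruct (E_exhausts HL) as [j Hj].
  exists (i + j). unfold stage. apply in_flat_map. exists i.
  split; [apply in_seq; lia|]. apply in_map. apply in_flat_map. exists j.
  split; [apply in_seq; lia|exact Hj].
Qed.

(** [T] is the union of a chain of good contexts whose steps decide the successive stages. A finite
    part of [T] lies in one member of the chain, and is therefore good. *)
Lemma lindenbaum C0 : good C0 ->
  exists T : form P N -> Prop,
    (forall chi, In chi C0 -> T chi) /\
    (forall l, (forall chi, In chi l -> T chi) -> good l) /\
    (forall a A, L A -> T (At a A) \/
       exists l, (forall chi, In chi l -> T chi) /\ inconsistent (At a A :: l)) /\
    (forall a A, L (Box A) -> ~ T (At a (Box A)) -> exists c,
       T (At a (Dia (Nom c))) /\ ~ T (At c A)).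
Proof.
  intro H0.
  set (nxt := fun n C => epsilon (inhabits C) (fun C' => good C' /\ incl C C' /\
     forall theta, In theta (stage n) -> decided C' theta)).
  assert (Hnxt : forall n C, good C -> good (nxt n C) /\ incl C (nxt n C) /\
     forall theta, In theta (stage n) -> decided (nxt n C) theta).
  { intros n C HC. unfold nxt. apply epsilon_spec. apply decide_list, HC. }
  set (chain := fix chain n := match n with 0 => C0 | S m => nxt m (chain m) end).
  assert (Hgood : forall n, good (chain n)).
  { induction n; simpl; [exact H0|]. apply Hnxt, IHn. }
  assert (Hmono : forall n m, incl (chain n) (chain (n + m))).
  { intros n m. induction m as [|m IH].
    - rewrite Nat.add_0_r. apply incl_refl.
    - rewrite Nat.add_succ_r. apply incl_tran with (1 := IH). apply Hnxt, Hgood. }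
  set (T := fun chi => exists n, In chi (chain n)).
  assert (Hlist : forall l, (forall chi, In chi l -> T chi) -> exists n, incl l (chain n)).
  { induction l as [|x l IH]; intro Hl.
    - exists 0. intros x [].
    - destruct IH as [n Hn]; [intros chi H; apply Hl; right; exact H|].
      destruct (Hl x (or_introl eq_refl)) as [m Hm].
      exists (n + m). intros y [<-|Hy].
      + rewrite Nat.add_comm. apply Hmono, Hm.
      + apply Hmono, Hn, Hy. }
  assert (HTgood : forall l, (forall chi, In chi l -> T chi) -> good l).
  { intros l Hl. destruct (Hlist l Hl) as [n Hn]. destruct (Hgood n) as [H1 H2].
    split; [intros chi Hchi; apply H1, Hn, Hchi|].
    intro Hi. apply H2. revert Hi. apply inconsistent_incl, Hn. }
  assert (Hdec : forall a A, L A -> exists n, decided (chain n) (At a A)).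
  { intros a A HL. destruct (stage_exhausts a HL) as [n Hn]. exists (S n).
    simpl. apply Hnxt; [apply Hgood|exact Hn]. }
  exists T. split; [intros chi H; exists 0; exact H|].
  split; [exact HTgood|]. split.
  - intros a A HL. destruct (Hdec a A HL) as [n Hn].
    destruct (Hn a A eq_refl HL) as [H|[H _]]; [left; exists n; exact H|right].
    exists (chain n). split; [|exact H]. intros chi Hchi. exists n. exact Hchi.
  - intros a A HL HT. destruct (Hdec a (Box A) HL) as [n Hn].
    destruct (Hn a (Box A) eq_refl HL) as [H|[_ H]]; [exfalso; apply HT; exists n; exact H|].
    destruct (H A eq_refl) as [c [H1 H2]]. exists c. split; [exists n; exact H1|].
    (* The witness refutes [At c A] over a finite part of [T], so [T] cannot contain [At c A]. *)
    intro HTc. apply (HTgood (At c A :: chain n)); [|exact H2].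
    intros chi [<-|Hchi]; [exact HTc|exists n; exact Hchi].
Qed.

(** * Canonical model *)

Section CanonicalModel.
Context (T : form P N -> Prop).
Context (T_good : forall l, (forall chi, In chi l -> T chi) -> good l).
Context (T_max : forall a A, L A -> T (At a A) \/
  exists l, (forall chi, In chi l -> T chi) /\ inconsistent (At a A :: l)).
Context (T_henkin : forall a A, L (Box A) -> ~ T (At a (Box A)) ->
  exists c, T (At a (Dia (Nom c))) /\ ~ T (At c A)).

(** If [At a A] were missing, a finite [l'] from [T] would refute it, and [l ++ l'] would be
    inconsistent. *)
Lemma T_closed l a A : (forall chi, In chi l -> T chi) -> L A ->
  prov l (At a A) -> T (At a A).
Proof.
  intros Hl HL H. destruct (T_max a HL) as [HT|[l' [Hl' Hi]]]; [exact HT|].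
  exfalso.
  assert (Hll : forall chi, In chi (l ++ l') -> T chi).
  { intros chi Hchi. apply in_app_or in Hchi. destruct Hchi; auto. }
  destruct (T_good Hll) as [H1 H2]. apply H2.
  apply inconsistent_step with (At a A); [apply labelled_cons; auto| |].
  - revert H. apply prov_weaken, incl_appl, incl_refl.
  - revert Hi. apply inconsistent_incl.
    intros x [<-|Hx]; [left; reflexivity|right; apply in_or_app; auto].
Qed.

Lemma T_bot a : ~ T (At a Bot).
Proof.
  intro H. destruct (T_good (l := [At a Bot])) as [_ H2].
  - intros chi [<-|[]]. exact H.
  - apply H2. exists a. apply prov_hyp; [left; reflexivity|apply allowed_at, L_bot].
Qed.

Lemma T_refl a : T (At a (Nom a)).
Proof. apply T_closed with []; auto using at_refl. intros chi []. Qed.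

Lemma T_transport a b A : L A -> T (At a (Nom b)) -> T (At a A) -> T (At b A).
Proof.
  intros HL H1 H2. apply T_closed with [At a (Nom b); At a A];
    auto using at_transport. intros chi [<-|[<-|[]]]; auto.
Qed.

Lemma T_sym a b : T (At a (Nom b)) -> T (At b (Nom a)).
Proof. intro H. apply T_transport with a; auto using T_refl. Qed.

Lemma T_trans a b c : T (At a (Nom b)) -> T (At b (Nom c)) -> T (At a (Nom c)).
Proof. intros H1 H2. apply T_transport with b; auto using T_sym. Qed.

Lemma T_dia_transport a b c :
  T (At b (Nom c)) -> T (At a (Dia (Nom b))) -> T (At a (Dia (Nom c))).
Proof.
  intros H1 H2. apply T_closed with [At b (Nom c); At a (Dia (Nom b))];
    auto using at_dia_transport. intros chi [<-|[<-|[]]]; auto.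
Qed.

Definition nrep (a : N) : N := rep (fun a b => T (At a (Nom b))) a.

Lemma nrep_rel a : T (At a (Nom (nrep a))).
Proof. unfold nrep. apply rep_rel with (E := fun a b => T (At a (Nom b))), T_refl. Qed.

Lemma nrep_eq a b : nrep a = nrep b <-> T (At a (Nom b)).
Proof.
  unfold nrep. apply rep_eq with (E := fun a b => T (At a (Nom b)));
    eauto using T_refl, T_sym, T_trans.
Qed.

Lemma nrep_idem a : nrep (nrep a) = nrep a.
Proof. apply nrep_eq, T_sym, nrep_rel. Qed.

Lemma T_nrep a A : L A -> (T (At (nrep a) A) <-> T (At a A)).
Proof.
  intro HL. split; intro H.
  - apply T_transport with (nrep a); auto using T_sym, nrep_rel.
  - apply T_transport with a; auto using nrep_rel.
Qed.

(* As in [ultraproduct], the carrier is not quotiented. *)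
Definition canonical_model : model P :=
  @Model P N (inhabits (f 0))
    (fun a b => nrep b = b /\ T (At a (Dia (Nom b))))
    (fun a p => decide (T (At a (Prp p)))).

Lemma truth A : L A -> forall a,
  (@sat P N canonical_model nrep (nrep a) A <-> T (At a A)).
Proof.
  induction A as [p|b|A IHA B IHB|A IHA B IHB| |A IHA|b A IHA]; intros HL a; simpl.
  - rewrite decide_true. apply T_nrep, HL.
  - apply nrep_eq.
  - destruct (L_and HL) as [HA HB]. rewrite IHA, IHB by assumption. split.
    + intros [H1 H2]. apply T_closed with [At a A; At a B]; auto using at_andI.
      intros chi [<-|[<-|[]]]; auto.
    + intro H. split.
      * apply T_closed with [At a (And A B)]; auto using at_andE1.
        intros chi [<-|[]]; auto.
      * apply T_closed with [At a (And A B)]; auto using at_andE2.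
        intros chi [<-|[]]; auto.
  - destruct (L_imp HL) as [HA HB]. rewrite IHA, IHB by assumption. split.
    (* Either [At a A], and with it [At a B], is in [T]; or a finite part of [T] refutes [At a A],
       and [exfalso] gives [At a B] under that assumption. *)
    + intro H. destruct (T_max a HA) as [HT|[l [Hl Hi]]].
      * apply T_closed with [At a B]; auto.
        { intros chi [<-|[]]; auto. }
        apply at_impI; auto using labelled_cons, labelled_nil.
        apply prov_hyp; [simpl; auto|apply allowed_at, HB].
      * destruct (T_good Hl) as [Hlab _]. apply T_closed with l; auto.
        apply at_impI; auto. apply exfalso; auto using labelled_cons.
    + intros H1 H2. apply T_closed with [At a (Imp A B); At a A];
        auto using at_impE. intros chi [<-|[<-|[]]]; auto.
  - split; [tauto|apply T_bot].
  - assert (HA := L_box HL). split.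
    + intro H. apply NNPP. intro HT.
      (* Accessibility leads only to representatives, so the successor used is [nrep c], to which
         the [Dia] statement is transported. *)
      destruct (T_henkin HL HT) as [c [H1 H2]]. apply H2. apply IHA; [exact HA|].
      apply H. split; [apply nrep_idem|].
      apply T_nrep; [apply L_dia|].
      apply T_dia_transport with c; auto using nrep_rel.
    + intros H v [Hv Hacc]. rewrite <- Hv. apply IHA; [exact HA|].
      rewrite T_nrep in Hacc by apply L_dia.
      apply T_closed with [At a (Box A); At a (Dia (Nom v))]; auto using at_boxE.
      intros chi [<-|[<-|[]]]; auto.
  - assert (HA := L_at HL). rewrite IHA by assumption. split; intro H.
    + apply T_closed with [At b A]; auto using at_atI. intros chi [<-|[]]; auto.
    + apply T_closed with [At a (At b A)]; auto using at_atE.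
      intros chi [<-|[]]; auto.
Qed.
End CanonicalModel.

(** * From saturated sets to derivations *)

(** By [stability] it suffices that an extension refuting [At a A] is inconsistent. Otherwise a
    saturated set above it gives a model of [C]; validity then puts [At a A] into the set, against
    the refutation. *)
Lemma labelled_completeness C a A : labelled C -> L A ->
  (forall (M : model P) (g : N -> world M),
     (forall b B, In (At b B) C -> sat g (g b) B) -> sat g (g a) A) ->
  prov C (At a A).
Proof.
  intros HC HL Hval. apply stability; auto. intros C' HC' HCC' Hi.
  apply NNPP. intro Hcon.
  destruct (@lindenbaum C' (conj HC' Hcon)) as [T [T0 [T1 [T2 T3]]]].
  assert (HT : T (At a A)).
  { apply (truth T1 T2 T3 HL a). apply Hval. intros b B HB.
    assert (HLB : L B).
    { destruct (HC _ HB) as [b' [B' [EB HB']]]. injection EB as _ ->. exact HB'. }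
    apply (truth T1 T2 T3 HLB b). apply T0, HCC', HB. }
  destruct (T1 (At a A :: C')) as [_ H]; [|exact (H Hi)].
  intros chi [<-|Hchi]; auto.
Qed.

(** (Name) supplies a fresh name [d] for the current world. Premises are labelled by [d] with (@I),
    and the conclusion is unlabelled with (@E). *)
Lemma completeness Gamma phi : (forall xi, In xi Gamma -> L xi) -> L phi ->
  (forall (M : model P) (g : N -> world M) (w : world M),
     (forall xi, In xi Gamma -> sat g w xi) -> sat g w phi) ->
  prov Gamma phi.
Proof.
  intros HG HL Hval. destruct (fresh_list (phi :: Gamma)) as [d Hd].
  apply prov_name with d; [exact Hd|].
  apply prov_atE with d; [exact HL| |].
  { apply prov_hyp; [left; reflexivity|apply allowed_L, L_nom]. }
  assert (Hlab : labelled (map (At d) Gamma)).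
  { intros chi H. apply in_map_iff in H. destruct H as [xi [<- H]]. eauto. }
  apply prov_cut with (map (At d) Gamma); [exact Hlab| |].
  - intros chi H. apply in_map_iff in H. destruct H as [xi [<- H]].
    apply prov_atI; [auto| |].
    + apply prov_hyp; [left; reflexivity|apply allowed_L, L_nom].
    + apply prov_hyp; [right; exact H|apply allowed_L, HG, H].
  - apply labelled_completeness; [exact Hlab|exact HL|].
    intros M g H. apply Hval. intros xi Hxi. apply H. apply in_map, Hxi.
Qed.
End Analytic.

(** * Analyticity *)

Lemma subformula_refl (P N : Type) (phi : form P N) : subformula phi phi.
Proof. destruct phi; left; reflexivity. Qed.

Lemma subformula_trans (P N : Type) (chi psi phi : form P N) :
  subformula chi psi -> subformula psi phi -> subformula chi phi.
Proof.
  intro H. induction phi; simpl; intros [->|H2]; try exact H; try tauto.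
Qed.

Lemma subformula_finite (P N : Type) (phi : form P N) :
  exists l, forall psi, subformula psi phi -> In psi l.
Proof.
  induction phi as [p|a|A [l IHA] B [m IHB]|A [l IHA] B [m IHB]| |A [l IHA]|a A [l IHA]].
  - exists [Prp p]. simpl. intuition congruence.
  - exists [Nom a]. simpl. intuition congruence.
  - exists (And A B :: l ++ m). simpl. intros psi [->|[H|H]]; auto;
      right; apply in_or_app; auto.
  - exists (Imp A B :: l ++ m). simpl. intros psi [->|[H|H]]; auto;
      right; apply in_or_app; auto.
  - exists [Bot]. simpl. intuition congruence.
  - exists (Box A :: l). simpl. intros psi [->|H]; auto.
  - exists (At a A :: l). simpl. intros psi [->|H]; auto.
Qed.

Lemma subformula_of_data_trans (P N : Type) (Gamma : form P N -> Prop)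
    (phi chi psi : form P N) :
  subformula chi psi -> subformula_of_data Gamma phi psi ->
  subformula_of_data Gamma phi chi.
Proof.
  intros H [H1|[xi [H1 H2]]]; [left|right; exists xi; split; [exact H1|]];
    eapply subformula_trans; eauto.
Qed.

Lemma subformula_of_data_mono (P N : Type) (Gamma Delta : form P N -> Prop)
    (phi psi : form P N) : (forall xi, Gamma xi -> Delta xi) ->
  subformula_of_data Gamma phi psi -> subformula_of_data Delta phi psi.
Proof. intros H [H1|[xi [H1 H2]]]; [left|right]; eauto. Qed.

Lemma subformula_of_data_finite (P N : Type) (Gamma : list (form P N)) (phi : form P N) :
  exists l, forall psi, subformula_of_data (fun xi => In xi Gamma) phi psi -> In psi l.
Proof.
  induction Gamma as [|xi Gamma [l IH]].
  - destruct (subformula_finite phi) as [l Hl]. exists l.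
    intros psi [H|[xi [[] _]]]. auto.
  - destruct (subformula_finite xi) as [m Hm]. exists (m ++ l).
    intros psi H. apply in_or_app.
    destruct H as [H|[xi' [[<-|H1] H2]]]; auto; right; apply IH; [left|right]; eauto.
Qed.

Lemma subformula_of_nominal_data_trans (P N : Type) (chi psi : form P N) :
  subformula chi psi -> subformula_of_nominal_data psi ->
  subformula_of_nominal_data chi.
Proof.
  intros H [c [H1|H1]]; exists c; [left|right]; eapply subformula_trans; eauto.
Qed.

(** The instance of [L] for the theorem. The labelled forms in the five properties come from
    [allowed], and nominals fall under [subformula_of_nominal_data]. *)
Definition analytic (P N : Type) (Gamma : form P N -> Prop) (phi psi : form P N) :
    Prop :=
  (subformula_of_data Gamma phi psi \/ subformula_of_nominal_data psi) \/
  (exists p, subformula_of_data Gamma phi (Prp p) /\ psi = Neg (Prp p)) \/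
  psi = Bot.

Lemma analytic_subformula (P N : Type) (Gamma : form P N -> Prop)
    (phi chi psi : form P N) :
  subformula chi psi -> analytic Gamma phi psi -> analytic Gamma phi chi.
Proof.
  intros H [[H1|H1]|[[p [H1 ->]]| ->]].
  - left. left. eapply subformula_of_data_trans; eauto.
  - left. right. eapply subformula_of_nominal_data_trans; eauto.
  - simpl in H. destruct H as [->|[[->|[]]|[->|[]]]].
    + right. left. eauto.
    + left. left. exact H1.
    + right. right. reflexivity.
  - destruct H as [->|[]]. right. right. reflexivity.
Qed.

(** For a finite list of premises only the formulas built from nominals are infinite in number, and
    these are listed along [f]. *)
Lemma analytic_enumerable (P N : Type) (f : nat -> N)
    (f_surj : forall a, exists n, f n = a) (Gamma : list (form P N)) (phi : form P N) :
  exists E : nat -> list (form P N), forall psi,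
    analytic (fun xi => In xi Gamma) phi psi -> exists n, In psi (E n).
Proof.
  destruct (subformula_of_data_finite Gamma phi) as [l Hl].
  exists (fun n => Nom (f n) :: Neg (Nom (f n)) :: Box (Neg (Nom (f n))) ::
            Dia (Nom (f n)) :: Bot :: l ++ map (@Neg P N) l).
  intros psi [[H|[c H]]|[[p [H ->]]| ->]].
  - exists 0. do 5 right. apply in_or_app. auto.
  - destruct (f_surj c) as [n <-]. exists n. simpl in *. intuition subst; auto 10.
  - exists 0. do 5 right. apply in_or_app. right. apply in_map. auto.
  - exists 0. simpl. auto 10.
Qed.

Theorem theoremA3 (P N : Type)
  (N_countably_infinite : exists f : nat -> N, Bijective f)
  (Gamma : form P N -> Prop) (phi : form P N) :
  (forall (M : model P) (w : world M) (g : N -> world M),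
     (forall xi, Gamma xi -> sat g w xi) -> sat g w phi) ->
  exists d : tree P N,
    derivation Gamma phi d /\
    forall theta : form P N, occurs theta d ->
      (exists a psi, theta = At a psi /\
         (subformula_of_data Gamma phi psi \/ subformula_of_nominal_data psi)) \/
      (subformula_of_data Gamma phi theta \/ subformula_of_nominal_data theta) \/
      (exists a, theta = Nom a) \/
      (exists p, subformula_of_data Gamma phi (Prp p) /\
         ((exists a, theta = At a (Neg (Prp p))) \/ theta = Neg (Prp p))) \/
      ((exists a, theta = At a Bot) \/ theta = Bot).
Proof.
  intro Hval. destruct N_countably_infinite as [f [h [hf fh]]].
  assert (f_inj : forall m n, f m = f n -> m = n).
  { intros m n H. rewrite <- (hf m), <- (hf n), H. reflexivity. }
  assert (f_surj : forall a, exists n, f n = a) by (intro a; exists (h a); apply fh).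
  assert (Hfin : exists l, (forall xi, In xi l -> Gamma xi) /\
    forall (M : model P) (g : N -> world M) (w : world M),
      (forall xi, In xi l -> sat g w xi) -> sat g w phi).
  (* If no finite part of [Gamma] entailed [phi], then [Gamma] with [Neg phi] would be finitely
     satisfiable, hence satisfiable. *)
  { apply NNPP. intro Hno.
    destruct (@compactness P N (fun xi => Gamma xi \/ xi = Neg phi)) as [M [g [w H]]].
    - intros l Hl. apply NNPP. intro Hunsat. apply Hno.
      assert (Hl' : exists l', (forall xi, In xi l' -> Gamma xi) /\
                forall xi, In xi l -> In xi l' \/ xi = Neg phi).
      { clear - Hl. induction l as [|xi l IH].
        - exists []. split; intros xi [].
        - destruct IH as [l' [H1 H2]]; [intros; apply Hl; right; assumption|].
          destruct (Hl xi (or_introl eq_refl)) as [H|H].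
          + exists (xi :: l'). split.
            * intros xi' [<-|H']; auto.
            * intros xi' [<-|H']; simpl; [auto|]. destruct (H2 _ H'); auto.
          + exists l'. split; [exact H1|]. intros xi' [<-|H']; auto. }
      destruct Hl' as [l' [H1 H2]]. exists l'. split; [exact H1|].
      intros M g w Hsat. apply NNPP. intro Hphi. apply Hunsat.
      exists M, g, w. intros xi Hxi.
      destruct (H2 xi Hxi) as [H| ->]; [auto|exact Hphi].
    - apply (H (Neg phi)); [auto|]. apply Hval. auto. }
  destruct Hfin as [l [Hl Hsat]].
  destruct (analytic_enumerable f_surj l phi) as [E HE].
  set (L := analytic (fun xi => In xi l) phi).
  assert (HL : forall psi chi, subformula chi psi -> L psi -> L chi).
  { intros psi chi. apply analytic_subformula. }
  assert (Hrefl := @subformula_refl P N).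
  destruct (@completeness P N L) with (f := f) (E := E) (Gamma := l) (phi := phi)
    as [d [H1 [H2 [H3 H4]]]]; auto.
  - intros A B H. split; revert H; apply HL; simpl; auto.
  - intros A B H. split; revert H; apply HL; simpl; auto.
  - intros A. apply HL. simpl. auto.
  - intros a A. apply HL. simpl. auto.
  - intros a. left. right. exists a. auto.
  - intros a. left. right. exists a. auto.
  (* An ordinary symbol is no subformula of [c] or [Dia c], so it comes from the data, as property
     (iv) demands. *)
  - intros p [[H|[c H]]|[[q [_ H]]|H]]; try discriminate H.
    + right. left. eauto.
    + exfalso. simpl in H. unfold Neg in H. intuition discriminate.
  - right. right. reflexivity.
  - intros xi Hxi. left. left. right. eauto.
  - left. left. left. auto.
  - exists d. split.
    { split; [exact H1|]. split; [exact H2|].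
      intros j chi H. apply Hl. apply (H3 _ _ H). }
    (* Analyticity was obtained relative to the finite list [l] and passes to [Gamma], which
       contains it. *)
    assert (Hmono := fun psi => @subformula_of_data_mono P N _ Gamma phi psi Hl).
    intros theta Htheta.
    destruct (H4 theta Htheta) as [H|[a [psi [-> H]]]];
      destruct H as [[H|H]|[[p [H ->]]| ->]]; eauto 10.
Qed.
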